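(* For every connected graph $G$ (with at least one edge), we have $2G\notin\mathscr{H}$.
   Context: $2G$ denotes the disjoint union of two copies of $G$; $P_5$ is the path on $5$ vertices. An edge-colored graph is rainbow if all its edges have distinct colors and monochromatic if all its edges have the same color. $R_3(H)$ is the minimum $n$ such that every coloring of the edges of $K_n$ with at most $3$ colors contains a monochromatic copy of $H$. The Gallai-Ramsey number $gr_k(G:H)$ is the minimum integer $n$ such that every coloring of the edges of $K_n$ using at most $k$ colors contains either a rainbow copy of $G$ or a monochromatic copy of $H$. $\mathscr{H}$ denotes the set of graphs $H$ with no isolated vertices for which $gr_k(P_5:H)>R_3(H)$ for some positive integer $k$. *)

(* Defs.v *)
From mathcomp Require Import all_boot.

Set Implicit Arguments.
Unset Strict Implicit.
Unset Printing Implicit Defensive.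

Record sgraph := SGraph {
  vertex :> finType;
  adj : rel vertex;
  adj_sym : symmetric adj;
  adj_irr : irreflexive adj }.

Definition connected_graph (G : sgraph) : Prop :=
  0 < #|G| /\ forall x y : G, connect (@adj G) x y.

Definition has_edge (G : sgraph) : Prop := exists x y : G, adj x y.

Definition no_isolated_vertex (G : sgraph) : Prop :=
  forall x : G, exists y : G, adj x y.

Definition path_adj (n : nat) : rel 'I_n :=
  fun i j => (i.+1 == j :> nat) || (j.+1 == i :> nat).

Lemma path_adj_sym n : symmetric (@path_adj n).
Proof. by move=> i j; rewrite /path_adj orbC. Qed.

Lemma path_adj_irr n : irreflexive (@path_adj n).
Proof. by move=> i; rewrite /path_adj orbb gtn_eqF. Qed.

Definition path_graph (n : nat) : sgraph :=
  SGraph (@path_adj_sym n) (@path_adj_irr n).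

Definition double_adj (G : sgraph) : rel (G + G) :=
  fun a b => match a, b with
             | inl x, inl y | inr x, inr y => adj x y
             | _, _ => false
             end.

Lemma double_adj_sym (G : sgraph) : symmetric (@double_adj G).
Proof. by move=> [x|x] [y|y] //=; apply: adj_sym. Qed.

Lemma double_adj_irr (G : sgraph) : irreflexive (@double_adj G).
Proof. by move=> [x|x] /=; apply: adj_irr. Qed.

Definition double_graph (G : sgraph) : sgraph :=
  SGraph (@double_adj_sym G) (@double_adj_irr G).

(* The color of the edge xy of K_n, x != y, is c [set x; y]; the values of c  *)
(* on sets that are not pairs are never used. The map need not be onto 'I_k,  *)
(* so at most k colors occur.                                                 *)
Definition coloring (k n : nat) := {ffun {set 'I_n} -> 'I_k}.

(* Every injection of the vertices of H into those of K_n is a copy of H.     *)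
Definition mono_copy (H : sgraph) (k n : nat) (c : coloring k n) : bool :=
  [exists f : {ffun H -> 'I_n}, injectiveb f &&
    [exists a : 'I_k, forall u : H, forall v : H,
       adj u v ==> (c [set f u; f v] == a)]].

Definition rainbow_copy (G : sgraph) (k n : nat) (c : coloring k n) : bool :=
  [exists f : {ffun G -> 'I_n}, injectiveb f &&
    [forall u : G, forall v : G, forall x : G, forall y : G,
       [&& adj u v, adj x y & [set u; v] != [set x; y]] ==>
       (c [set f u; f v] != c [set f x; f y])]].

Definition ramsey_prop (k : nat) (H : sgraph) : pred nat :=
  fun n => [forall c : coloring k n, mono_copy H c].

Definition gallai_ramsey_prop (k : nat) (G H : sgraph) : pred nat :=
  fun n => [forall c : coloring k n, rainbow_copy G c || mono_copy H c].

Lemma pigeonhole_class (T C : finType) (g : T -> C) (A : {set T}) (N : nat) :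
  #|C| * N < #|A| -> exists a : C, N < #|[set x in A | g x == a]|.
Proof.
move=> ltA; apply/existsP; apply: contraLR ltA => /existsPn small.
rewrite -leqNgt -sum1_card (partition_big g xpredT) //=.
rewrite -sum_nat_const; apply: leq_sum => a _.
by rewrite sum1dep_card leqNgt; apply: small.
Qed.

(* The multicolor Ramsey theorem, needed for the minima below to exist.       *)
Lemma ramsey_sets (C : finType) (m : nat) (t : C -> nat) :
  \sum_a t a <= m ->
  exists N, forall (T : finType) (c : {set T} -> C) (A : {set T}), N <= #|A| ->
  exists (a : C) (B : {set T}), [/\ B \subset A, #|B| = t a &
    forall x y, x \in B -> y \in B -> x != y -> c [set x; y] = a].
Proof.
elim: m t => [|m IH] t le_t; last have [/existsP[a /eqP ta0] | /existsPn t_gt0] :=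
  boolP [exists a, t a == 0].
- exists 1 => T c A /card_gt0P[x _]; exists (c set0), set0; rewrite sub0set cards0.
  split=> // [|y z]; last by rewrite inE.
  apply/esym/eqP; rewrite -leqn0 (leq_trans _ le_t) //.
  by rewrite (bigD1 (c set0)) //= leq_addr.
- exists 0 => T c A _; exists a, set0; rewrite sub0set cards0 ta0.
  by split=> // y z; rewrite inE.
have {IH} /fin_all_exists[N NP] : forall a : C, exists N,
    forall (T : finType) (c : {set T} -> C) (A : {set T}), N <= #|A| ->
    exists (b : C) (B : {set T}), [/\ B \subset A, #|B| = t b - (b == a) &
    forall x y, x \in B -> y \in B -> x != y -> c [set x; y] = b].
  move=> a; apply: (IH (fun b => t b - (b == a))).
  rewrite -ltnS (leq_trans _ le_t) //.
  rewrite (bigD1 a) //= [leqRHS](bigD1 a) //= eqxx subn1.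
  rewrite -addSn prednK ?lt0n // leq_add2l; apply: leq_sum => b _.
  exact: leq_subr.
exists (#|C| * \max_a N a).+2 => T c A ltA.
have /card_gt0P[x xA] : 0 < #|A| by apply: leq_trans ltA.
have ltAx : #|C| * \max_a N a < #|A :\ x|.
  by rewrite (cardsD1 x A) xA in ltA.
have [a lt_a] := pigeonhole_class (fun y => c [set x; y]) ltAx.
have leNa := leq_trans (leq_bigmax a) (ltnW lt_a).
have [b [B [sB cB mB]]] := NP a T c _ leNa.
have inB y : y \in B -> [/\ y != x, y \in A & c [set x; y] = a].
  by move=> /(subsetP sB); rewrite !inE -andbA => /and3P[-> -> /eqP].
have sBA : B \subset A by apply/subsetP=> y /inB[].
have [eba|nba] := eqVneq b a; last first.
  by exists b, B; rewrite cB (negPf nba) subn0.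
exists a, (x |: B); split.
- by rewrite subUset sub1set xA.
- have xNB : x \notin B by apply/negP => /inB[]; rewrite eqxx.
  by rewrite cardsU1 xNB cB eba eqxx add1n subn1 prednK // lt0n.
move=> y z; rewrite !inE => /orP[/eqP->|yB] /orP[/eqP->|zB].
- by rewrite eqxx.
- by case: (inB z zB).
- by rewrite setUC; case: (inB y yB).
by rewrite -eba; apply: mB.
Qed.

Lemma ramsey_exists (k : nat) (H : sgraph) : exists n, ramsey_prop k H n.
Proof.
have [N NP] := ramsey_sets (leqnn (\sum_(a < k) #|H|)).
exists N; apply/forallP => c.
have [|a [B [_ cB mB]]] := NP _ c [set: 'I_N]; first by rewrite cardsT card_ord.
pose f := [ffun u : H => enum_val (cast_ord (esym cB) (enum_rank u))].
have f_inj : injective f.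
  by move=> u v; rewrite !ffunE => /enum_val_inj/cast_ord_inj/enum_rank_inj.
apply/existsP; exists f; apply/andP; split; first exact/injectiveP.
apply/existsP; exists a; apply/forallP => u; apply/forallP => v.
apply/implyP => uv; apply/eqP/mB; rewrite ?ffunE ?enum_valP //.
rewrite -!(ffunE (fun u : H => enum_val (cast_ord (esym cB) (enum_rank u)))).
by rewrite (inj_eq f_inj); apply: contraTneq uv => ->; rewrite adj_irr.
Qed.

Lemma gallai_ramsey_exists (k : nat) (G H : sgraph) :
  exists n, gallai_ramsey_prop k G H n.
Proof.
have [n /forallP nP] := ramsey_exists k H.
by exists n; apply/forallP => c; rewrite nP orbT.
Qed.

Definition ramsey (k : nat) (H : sgraph) : nat := ex_minn (ramsey_exists k H).

Definition gallai_ramsey (k : nat) (G H : sgraph) : nat :=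
  ex_minn (gallai_ramsey_exists k G H).

Definition in_scrH (H : sgraph) : Prop :=
  no_isolated_vertex H /\
  exists k : nat, 0 < k /\ ramsey 3 H < gallai_ramsey k (path_graph 5) H.

(* Main.v *)
Require Import Defs.
From mathcomp Require Import all_boot perm.

Set Implicit Arguments.
Unset Strict Implicit.
Unset Printing Implicit Defensive.

(* Let n = R_3(2G) and color the edges of K_n without a rainbow P_5; coloring *)
(* all edges outside two stars alike shows n >= 2|G| + 2 >= 6.                *)
(* If at most three colors occur, we are done. If every vertex sees at most   *)
(* two colors and four colors occur, some color a is seen by all vertices, so *)
(* that K_n splits into parts, one for each other color, such that all edges  *)
(* between parts have the color a. Otherwise some vertex sees three colors    *)
(* and a fourth color occurs: among six vertices there is then one of two     *)
(* configurations on four vertices, each of which forces a single color on    *)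
(* all edges that avoid two vertices r, s, except maybe one edge pq. The graph*)
(* 2G embeds there, with p in the first copy of G and q in the second.        *)
(* In the partitioned case, assume that more than two parts contain a copy of *)
(* G in their own color (two such parts allow merging down to three colors).  *)
(* Recolor the edges between these parts with a new color, merge the remaining*)
(* vertices into one of the parts, and in each other part recolor the edges at*)
(* one copy of G so that no copy of G in a single color remains there.        *)

(** The argument is carried by [p5_free_two_mono]: any coloring without a rainbow $P_5$, with any
    number of colors, of a complete graph satisfying [two_ramsey] for three colors has a
    monochromatic $2G$. The sets of colors seen at the vertices meet pairwise. If all have size at
    most two, they share a color ([dominated_two_mono], through [few_rich] and [many_rich]) or lie
    within three colors ([few_colors]). Otherwise [core_exists] yields a four-vertex core unless
    three colors suffice, and [core_two_mono] embeds $2G$ in the color that the core forces. The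
    facts about cores concern six vertices only, so they are decided by running through the equality
    patterns of the 15 edge colors of $K_6$; patterns make the number of colors irrelevant. *)

(** * Exhaustive search over equality patterns *)

(** A literal states that two values are equal or different, according to its boolean. A cube is a
    conjunction of literals, a list of cubes a disjunction. *)
Definition literal := (bool * (nat * nat))%type.

Definition sat (T : eqType) (f : nat -> T) (cube : seq literal) : bool :=
  all (fun l => (f l.2.1 == f l.2.2) == l.1) cube.

Fixpoint distinct (s : seq nat) : seq literal :=
  if s is i :: s' then [seq (false, (i, j)) | j <- s'] ++ distinct s' else [::].

Lemma sat_distinct (T : eqType) (f : nat -> T) s :
  sat f (distinct s) = uniq (map f s).
Proof.
elim: s => //= i s <-; rewrite /sat all_cat; congr (_ && _).
by elim: s => //= j s ->; rewrite inE negb_or eqbF_neg.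
Qed.

(* [if] rather than [||], whose two sides [vm_compute] would evaluate.        *)
(* The word [w] is a pattern of equalities among the first [size w] values:   *)
(* the next value is one of the [k] values already met, or a new one.         *)
Fixpoint search (css : seq (seq (seq literal))) (w : seq nat) (k : nat) : bool :=
  if css is cs :: css' then
    all (fun i => if has (sat (nth 0 (rcons w i))) cs then true
                  else search css' (rcons w i) (maxn k i.+1)) (iota 0 k.+1)
  else false.

Definition below (m : nat) (cube : seq literal) : bool :=
  all (fun l => (l.2.1 <= m) && (l.2.2 <= m)) cube.

Definition mentions (m : nat) (cube : seq literal) : bool :=
  has (fun l => (l.2.1 == m) || (l.2.2 == m)) cube.

(** Each cube is filed under its largest index, so that it is tested, and prunes the search, as soon
    as the pattern decides it. *)
Definition exhaustive (m : nat) (cubes : seq (seq literal)) : bool :=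
  search [seq [seq c <- cubes | below t c && mentions t c] | t <- iota 0 m] [::] 0.

(** The function [f] follows the branch of its own pattern, with [cols] the distinct values met so
    far; a successful search ends this branch at a satisfied cube. *)
Lemma searchP (T : eqType) (f : nat -> T) css w cols :
    uniq cols ->
    (forall i, i < size w -> nth 0 w i < size cols /\
                             f i = nth (f 0) cols (nth 0 w i)) ->
    (forall t, all (below (size w + t)) (nth [::] css t)) ->
  search css w (size cols) -> has (has (sat f)) css.
Proof.
elim: css w cols => [//|cs css IH] w cols Uc wP bP /allP search_w.
(* For a new value, [index] returns [size cols], which is the code of a new value in the search. *)
pose i := index (f (size w)) cols.
have le_ik : i <= size cols by apply: index_size.
have [cols' [Uc' sc fi cP]] : exists cols' : seq T,
    [/\ uniq cols', size cols' = maxn (size cols) i.+1,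
       nth (f 0) cols' i = f (size w) & forall j, j < size cols ->
       nth (f 0) cols' j = nth (f 0) cols j].
  have [fw|fw] := boolP (f (size w) \in cols).
    exists cols; split; rewrite ?nth_index //.
    by apply/esym/maxn_idPl; rewrite index_mem.
  exists (rcons cols (f (size w))); rewrite rcons_uniq fw Uc size_rcons.
  rewrite /i (memNindex fw) nth_rcons ltnn eqxx (maxn_idPr _) //.
  by split=> // j lt_j; rewrite nth_rcons lt_j.
have {}wP j : j < size (rcons w i) -> nth 0 (rcons w i) j < size cols' /\
    f j = nth (f 0) cols' (nth 0 (rcons w i) j).
  rewrite size_rcons ltnS leq_eqVlt nth_rcons => /orP[/eqP->|lt_j].
    by rewrite ltnn eqxx fi sc leq_maxr.
  have [lt_wj ->] := wP j lt_j; rewrite lt_j cP // sc.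
  by split=> //; apply: leq_trans lt_wj (leq_maxl _ _).
have iin : i \in iota 0 (size cols).+1 by rewrite mem_iota.
have := search_w i iin; case: ifP => [/hasP[c c_in /allP sat_c] _|_ found]; apply/orP; [left|right].
  apply/hasP; exists c => //; apply/allP => l lc.
  have /allP/(_ c c_in)/allP/(_ l lc)/andP[] := bP 0.
  rewrite -[_.1 <= _]ltnS -[_.2 <= _]ltnS addn0 -(size_rcons w i) => l1 l2.
  rewrite -(eqP (sat_c l lc)).
  have [b1 ->] := wP _ l1; have [b2 ->] := wP _ l2.
  by rewrite nth_uniq.
apply: (IH (rcons w i) cols') => // [t|]; last by rewrite sc.
by rewrite size_rcons addSnnS; apply: (bP t.+1).
Qed.

Lemma exhaustiveP (T : eqType) (f : nat -> T) m cubes :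
  exhaustive m cubes -> has (sat f) cubes.
Proof.
move=> H; have /hasP[] // : has (has (sat f))
    [seq [seq c <- cubes | below t c && mentions t c] | t <- iota 0 m].
  apply: (@searchP _ f _ [::] [::]) => // t.
  have [lt_tm|le_mt] := ltnP t m; last by rewrite nth_default ?size_map ?size_iota.
  rewrite (nth_map 0) ?size_iota // nth_iota // add0n.
  by apply/allP => c; rewrite mem_filter => /andP[/andP[]].
move=> cs /mapP[t _ ->] /hasP[c]; rewrite mem_filter => /andP[_ cin] sc.
by apply/hasP; exists c.
Qed.

(** * Searches in colorings of $K_6$ *)

Definition k6_edges : seq (nat * nat) :=
  [:: (0, 1); (0, 2); (1, 2); (0, 3); (1, 3); (2, 3); (0, 4); (1, 4); (2, 4);
      (3, 4); (0, 5); (1, 5); (2, 5); (3, 5); (4, 5)].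

(* The searches are small because the edges of [first], which are those with  *)
(* prescribed colors, are assigned first.                                     *)
Definition eid (first : seq (nat * nat)) : nat -> nat -> nat :=
  let r := first ++ [seq p <- k6_edges | p \notin first] in
  fun i j => index (minn i j, maxn i j) r.

Fixpoint arrangements (r : nat) : seq (seq nat) :=
  if r is r'.+1 then
    [seq i :: s | s <- arrangements r', i <- [seq i <- iota 0 6 | i \notin s]]
  else [:: [::]].

Lemma arrangementsP r s : s \in arrangements r ->
  [/\ size s = r, uniq s & all (ltn^~ 6) s].
Proof.
elim: r s => [|r IH] s; first by rewrite inE => /eqP->.
case/allpairsPdep => t [i [/IH[<- Ut At]]].
by rewrite mem_filter mem_iota => /andP[it /andP[_ lt_i]] ->; rewrite /= it Ut At lt_i.
Qed.

Definition p5_cubes (E : nat -> nat -> nat) : seq (seq literal) :=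
  [seq distinct (pairmap E (head 0 s) (behead s)) | s <- arrangements 5].

Definition star_cube (E : nat -> nat -> nat) (a b c d : nat) : seq literal :=
  distinct [:: E a b; E a c; E a d; E b c] ++
  [:: (true, (E b c, E b d)); (true, (E b c, E c d))].

Definition triangle_cubes (E : nat -> nat -> nat) (a b c x : nat) : seq (seq literal) :=
  [seq distinct [:: E a b; E a c; E b c; E x b] ++
       [:: (true, (E x b, E x c)); (true, (E x a, i))]
  | i <- [:: E x b; E b c]].

Definition core_cubes (E : nat -> nat -> nat) : seq (seq literal) :=
  flatten [seq (if s is [:: a; b; c; d] then
                  star_cube E a b c d :: triangle_cubes E a b c d else [::])
          | s <- arrangements 4].

(** Hypotheses enter a search negated, as further cubes; these cubes discard the patterns in which
    the values indexed by [s] are not distinct. *)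
Definition equal_cubes (s : seq nat) : seq (seq literal) :=
  [seq [:: (true, l.2)] | l <- distinct s].

Lemma sat_equal (T : eqType) (f : nat -> T) s :
  has (sat f) (equal_cubes s) -> ~~ uniq (map f s).
Proof.
have neg : all (fun l => ~~ l.1) (distinct s).
  by elim: s => //= i s IH; rewrite all_cat IH andbT all_map; apply/allP.
rewrite has_map -sat_distinct => /hasP[l l_in /andP[/eqP eq_l _]].
by apply/allPn; exists l => //; rewrite /= in eq_l; rewrite eq_l eq_sym eqb_id (allP neg).
Qed.

Definition cores_found (i j : nat) : bool :=
  let E := eid [:: (0, 1); (0, 2); (0, 3); (i, j)] in
  exhaustive 15 (p5_cubes E ++ core_cubes E ++
                 equal_cubes [:: E 0 1; E 0 2; E 0 3; E i j]).

Definition p5_free (V : finType) (C : eqType) (e : V -> V -> C) : Prop :=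
  forall (x : V) (s : seq V), size s = 4 -> uniq (x :: s) -> ~~ uniq (pairmap e x s).

Section SixVertices.

Variables (V : finType) (C : eqType) (e : V -> V -> C) (P : nat -> V).
Hypotheses (e_sym : forall x y, e x y = e y x) (e_free : p5_free e).
Hypothesis P_inj : {in gtn 6 &, injective P}.

Lemma exhaustive_k6 first extra :
    exhaustive 15 (p5_cubes (eid first) ++ extra) ->
  exists f : nat -> C, has (sat f) extra /\
  forall i j, i < 6 -> j < 6 -> i != j -> f (eid first i j) = e (P i) (P j).
Proof.
pose r := first ++ [seq p <- k6_edges | p \notin first].
pose f k := e (P (nth (0, 0) r k).1) (P (nth (0, 0) r k).2).
have fE i j : i < 6 -> j < 6 -> i != j -> f (eid first i j) = e (P i) (P j).
  move=> lt_i lt_j ij; have r_ij : (minn i j, maxn i j) \in r.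
    rewrite mem_cat mem_filter; case: (_ \in first) => //=.
    by move: lt_i lt_j ij; case: i => [|[|[|[|[|[|i]]]]]] //;
       case: j => [|[|[|[|[|[|j]]]]]].
  by rewrite /f /eid -/r (nth_index _ r_ij) /=; have [_|_] := leqP i j; last rewrite e_sym.
move/(@exhaustiveP _ f); move: (eid first) (f) fE => E {}f fE.
rewrite has_cat => /orP[|sat_f]; last by exists f.
case/hasP => c /mapP[s /arrangementsP[]]; case: s => // i s [szs] Us As ->.
rewrite sat_distinct => Uc; suff /negP[] : ~~ uniq (pairmap e (P i) (map P s)).
  move: Uc; congr (is_true (uniq _)).
  elim: s i Us As {szs} => //= j s IH i /andP[+ Us] /and3P[lt_i lt_j As].
  rewrite inE negb_or => /andP[ij _].
  by rewrite fE // IH //= lt_j.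
apply: e_free; rewrite ?size_map // -map_cons map_inj_in_uniq //.
by move=> x y /(allP As) ltx /(allP As) lty; apply: P_inj.
Qed.

(** A rainbow star at [a] whose leaves span a triangle in a fourth color. *)
Definition star_core (a b c d : V) : bool :=
  [&& uniq [:: e a b; e a c; e a d; e b c], e b c == e b d & e b c == e c d].

(** A rainbow triangle [abc] with a vertex [x] joined to [b] and [c] in a fourth color. *)
Definition triangle_core (a b c x : V) : bool :=
  [&& uniq [:: e a b; e a c; e b c; e x b], e x b == e x c &
      e x a \in [:: e x b; e b c]].

Lemma core_in_k6 i j :
    i < 6 -> j < 6 -> i != j -> cores_found i j ->
    uniq [:: e (P 0) (P 1); e (P 0) (P 2); e (P 0) (P 3); e (P i) (P j)] ->
  exists a b c d, uniq [:: a; b; c; d] /\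
    (star_core a b c d \/ triangle_core a b c d).
Proof.
move=> lt_i lt_j ij /exhaustive_k6[f [+ fE]] U.
move: (eid _) fE => E fE; rewrite has_cat => /orP[|/sat_equal]; last first.
  by move: U; rewrite /= !fE // => ->.
case/hasP=> c /flattenP[cs /mapP[s /arrangementsP[]]].
case: s => [//|a [//|b [//|c1 [//|d [|//]]]]] _ Us As -> c_in sat_c.
have [lta ltb ltc ltd] : [/\ a < 6, b < 6, c1 < 6 & d < 6] by case/and5P: As.
exists (P a), (P b), (P c1), (P d); split.
  rewrite -[[:: _; _; _; _]]/(map P [:: a; b; c1; d]) map_inj_in_uniq //.
  by move=> x y /(allP As) ltx /(allP As) lty; apply: P_inj.
move: Us; rewrite /= !inE !negb_or -!andbA => /and5P[ab ac ad bc /and3P[bd cd _]].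
have [da db dc] : [/\ d != a, d != b & d != c1] by rewrite ![d == _]eq_sym.
move: c_in; rewrite inE => /orP[/eqP eq_c|/mapP[k k_in eq_c]]; [left|right];
  move: sat_c; rewrite eq_c /sat all_cat -/(sat _ _) sat_distinct.
  by rewrite /star_core /= !fE // !eqb_id !andbT.
rewrite [map _ _]/= /triangle_core => /andP[]; rewrite !fE // => ->.
rewrite /= !eqb_id !andbT !fE // => /andP[-> /eqP->].
by move: k_in; rewrite !inE => /orP[]/eqP->; rewrite !fE // eqxx ?orbT.
Qed.

End SixVertices.

Lemma k6_edgesP i j : i < j -> j < 6 -> (i, j) \in k6_edges.
Proof.
by case: j => [|[|[|[|[|[|j]]]]]] //; case: i => [|[|[|[|[|[|i]]]]]].
Qed.

(** The three edges left out are those of the star at [0], which cannot have a color different from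
    all colors of the star. *)
Lemma cores_found_all : all (fun p => cores_found p.1 p.2)
  [seq p <- k6_edges | (p.1 != 0) || (3 < p.2)].
Proof. by vm_cast_no_check (erefl true). Qed.

Definition star_forces (i j : nat) : bool :=
  let E := eid [:: (0, 1); (0, 2); (0, 3); (1, 2)] in
  exhaustive 15 (p5_cubes E ++
    equal_cubes [:: E 0 1; E 0 2; E 0 3; E 1 2] ++
    [:: [:: (false, (E 1 2, E 1 3))]; [:: (false, (E 1 2, E 2 3))];
        [:: (true, (E i j, E 1 2))]]).

Lemma star_forces_all :
  all (fun p => star_forces p.1 p.2) [seq p <- k6_edges | p.1 != 0].
Proof. by vm_cast_no_check (erefl true). Qed.

(* At least one of the edges of [ps] gets the color of the edge [(1, 3)].     *)
Definition triangle_forces (ps : seq (nat * nat)) : bool :=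
  let E := eid [:: (0, 1); (0, 2); (1, 2); (1, 3); (2, 3); (0, 3)] in
  exhaustive 15 (p5_cubes E ++
    equal_cubes [:: E 0 1; E 0 2; E 1 2; E 3 1] ++
    [:: [:: (false, (E 3 1, E 3 2))];
        [:: (false, (E 3 0, E 3 1)); (false, (E 3 0, E 1 2))]] ++
    [seq [:: (true, (E p.1 p.2, E 3 1))] | p <- ps]).

Lemma triangle_forces_outer :
  all (fun p => triangle_forces [:: p]) [seq p <- k6_edges | 2 < p.1].
Proof. by vm_cast_no_check (erefl true). Qed.

(** Here [0], [1], [2], [3] stand for [a], [b], [c], [x] of a triangle core, and the pairs are the
    ordered pairs of vertices outside the triangle. *)
Lemma triangle_forces_spokes :
  all (fun p => triangle_forces [:: (p.1, 2); (p.2, 0)])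
      [:: (3, 4); (3, 5); (4, 5); (4, 3); (5, 3); (5, 4)].
Proof. by vm_cast_no_check (erefl true). Qed.

Lemma extend_uniq (V : finType) (s : seq V) m :
    uniq s -> size s <= m <= #|V| ->
  exists t, uniq (s ++ t) /\ size (s ++ t) = m.
Proof.
move=> Us /andP[le_sm le_mV].
exists (take (m - size s) [seq x <- enum V | x \notin s]); split.
  rewrite cat_uniq Us (take_uniq _ (filter_uniq _ (enum_uniq V))) andbT /=.
  by apply/hasPn => x /mem_take; rewrite mem_filter => /andP[].
rewrite size_cat size_take_min (minn_idPl _) ?subnKC // size_filter.
rewrite leq_subLR (leq_trans le_mV) // cardE -(count_predC (mem s)) leq_add2r.
rewrite -size_filter; apply: uniq_leq_size; first by rewrite filter_uniq ?enum_uniq.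
by move=> x; rewrite mem_filter => /andP[].
Qed.

(** Four core vertices and one further edge span at most six vertices; padding to exactly six makes
    the searches in $K_6$ applicable. *)
Lemma six_points (V : finType) (s : seq V) x y :
    uniq s -> size s = 4 -> 6 <= #|V| ->
  exists P : nat -> V, [/\ {in gtn 6 &, injective P},
    forall i, i < 4 -> P i = nth x s i &
    exists i j, [/\ i < 6, j < 6, x = P i & y = P j]].
Proof.
move=> Us szs le6; pose r := [seq z <- undup [:: x; y] | z \notin s].
have Usr : uniq (s ++ r).
  rewrite cat_uniq Us filter_uniq ?undup_uniq // andbT.
  by apply/hasPn => z; rewrite mem_filter => /andP[].
have [|t [Ut szt]] := extend_uniq Usr (m := 6).
  rewrite le6 andbT size_cat szs (@leq_add2l 4 _ 2) size_filter.
  by rewrite (leq_trans (count_size _ _)) // (leq_trans (size_undup _)).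
have in6 z : z \in [:: x; y] -> z \in (s ++ r) ++ t.
  by rewrite !mem_cat mem_filter mem_undup => ->; case: (z \in s).
exists (nth x ((s ++ r) ++ t)); split=> [i j lt_i lt_j /eqP|i lt_i|].
- by rewrite nth_uniq ?szt // => /eqP.
- by rewrite -catA nth_cat szs lt_i.
exists (index x ((s ++ r) ++ t)), (index y ((s ++ r) ++ t)).
by rewrite -szt !index_mem !nth_index ?in6 ?inE ?eqxx ?orbT.
Qed.

(** * Rainbow-P5-free colorings with a vertex of three colors *)

Section Structure.

Variables (V : finType) (C : eqType) (e : V -> V -> C).
Hypotheses (e_sym : forall x y, e x y = e y x) (e_free : p5_free e).
Hypothesis V_ge6 : 6 <= #|V|.

Lemma core_exists v p1 p2 p3 s t :
    uniq [:: v; p1; p2; p3] -> s != t ->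
    uniq [:: e v p1; e v p2; e v p3; e s t] ->
  exists a b c d, uniq [:: a; b; c; d] /\
    (star_core e a b c d \/ triangle_core e a b c d).
Proof.
move=> Us st Ue; have [P [P_inj Ps [i [j [lt_i lt_j sP tP]]]]] :=
  six_points s t Us erefl V_ge6.
have [/= E0 E1 E2 E3] := And4 (Ps 0 isT) (Ps 1 isT) (Ps 2 isT) (Ps 3 isT).
rewrite -{}E0 -{}E1 -{}E2 -{}E3 {}sP {}tP in st Ue.
have {st} ij : i != j by apply: contraNneq st => ->.
wlog lt_ij : i j lt_i lt_j Ue ij / i < j => [W|].
  move: (ij); rewrite neq_ltn => /orP[lt_ij|lt_ji]; first by apply: (W i j).
  by apply: (W j i); rewrite ?(e_sym (P j)) // ltn_eqF.
have ij_in := k6_edgesP lt_ij lt_j.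
apply: (core_in_k6 e_sym e_free P_inj lt_i lt_j ij _ Ue).
move/allP: cores_found_all => /(_ (i, j)); apply; rewrite mem_filter ij_in andbT.
case: i Ue lt_ij {lt_i ij ij_in} => [|i] // Ue; case: j Ue {lt_j} => [|[|[|[|j]]]] //;
  by rewrite /= !inE eqxx ?orbT /= ?andbF.
Qed.

Lemma star_core_mono a b c d : uniq [:: a; b; c; d] -> star_core e a b c d ->
  forall x y, x != y -> x != a -> y != a -> e x y = e b c.
Proof.
move=> Us core x y xy xa ya; have [P [P_inj Ps [i [j [lt_i lt_j xP yP]]]]] :=
  six_points x y Us erefl V_ge6.
have [/= E0 E1 E2 E3] := And4 (Ps 0 isT) (Ps 1 isT) (Ps 2 isT) (Ps 3 isT).
rewrite -{}E0 -{}E1 -{}E2 -{}E3 {}xP {}yP in xy xa ya core *.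
have {xy} ij : i != j by apply: contraNneq xy => ->.
have {xa} i0 : i != 0 by apply: contraNneq xa => ->.
have {ya} j0 : j != 0 by apply: contraNneq ya => ->.
wlog lt_ij : i j lt_i lt_j ij i0 j0 / i < j => [W|].
  move: (ij); rewrite neq_ltn => /orP[lt_ij|lt_ji]; first by apply: (W i j).
  by rewrite (e_sym (P i)); apply: (W j i) => //; rewrite ltn_eqF.
have : star_forces i j.
  by move/allP: star_forces_all => /(_ (i, j)); apply; rewrite mem_filter i0 k6_edgesP.
case/(exhaustive_k6 e_sym e_free P_inj) => f [+ fE].
move: (eid _) fE => E fE; rewrite has_cat => /orP[/sat_equal|].
  by case/and3P: core => + _ _; rewrite /= !fE // => ->.
case/and3P: core => _ /eqP + /eqP.
by rewrite /= !fE // => -> ->; rewrite !eqxx /= orbF andbT eqb_id => /eqP.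
Qed.

Lemma triangle_core_outer a b c x :
    uniq [:: a; b; c; x] -> triangle_core e a b c x ->
  forall v w, v != w -> v \notin [:: a; b; c] -> w \notin [:: a; b; c] ->
    e v w = e x b /\ (e v c = e x b \/ e w a = e x b).
Proof.
move=> Us core v w vw vT wT; have [P [P_inj Ps [i [j [lt_i lt_j vP wP]]]]] :=
  six_points v w Us erefl V_ge6.
have [/= E0 E1 E2 E3] := And4 (Ps 0 isT) (Ps 1 isT) (Ps 2 isT) (Ps 3 isT).
rewrite -{}E0 -{}E1 -{}E2 -{}E3 {}vP {}wP in vw vT wT core *.
have {vw} ij : i != j by apply: contraNneq vw => ->.
have {vT} i2 : 2 < i.
  by case: i vT {lt_i ij} => [|[|[|i]]]; rewrite //= !inE eqxx ?orbT.
have {wT} j2 : 2 < j.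
  by case: j wT {lt_j ij} => [|[|[|j]]]; rewrite //= !inE eqxx ?orbT.
have forced ps : triangle_forces ps ->
    all (fun p => [&& p.1 < 6, p.2 < 6 & p.1 != p.2]) ps ->
    has (fun p => e (P p.1) (P p.2) == e (P 3) (P 1)) ps.
  case/(exhaustive_k6 e_sym e_free P_inj) => f [+ fE].
  move: (eid _) fE => E fE; rewrite has_cat => /orP[/sat_equal|].
    by case/and3P: core => + _ _; rewrite /= !fE // => ->.
  case/and3P: core => _ /eqP eq_x2; rewrite !inE => eq_x0 /orP[|/orP[|]].
  - by rewrite /= !fE // eq_x2 eqxx.
  - by move: eq_x0 => /orP[]/eqP eq_x0; rewrite /= !fE // eq_x0 eqxx ?andbF.
  rewrite -/(has (sat f) _) has_map => /hasP[p p_in] /= /andP[/eqP eq_p _] /allP/(_ p p_in).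
  case/and3P=> lt1 lt2 ne; apply/hasP; exists p => //.
  by move: eq_p; rewrite !fE // eqb_id.
have ij_in : (i, j) \in [:: (3, 4); (3, 5); (4, 5); (4, 3); (5, 3); (5, 4)].
  by move: lt_i lt_j ij i2 j2; case: i => [|[|[|[|[|[|i]]]]]] //;
     case: j => [|[|[|[|[|[|j]]]]]].
split; last first.
  have /allP/(_ _ ij_in)/forced := triangle_forces_spokes.
  rewrite /= !andbT !orbF lt_i lt_j !gtn_eqF ?(ltnW i2) ?(leq_trans _ j2) //.
  by case/(_ isT)/orP=> /eqP ->; [left | right].
have outer k l : k < l -> l < 6 -> 2 < k -> e (P k) (P l) = e (P 3) (P 1).
  move=> lt_kl lt_l k2; have /allP/(_ (k, l)) := triangle_forces_outer.
  rewrite mem_filter k2 k6_edgesP // => /(_ isT)/forced; rewrite /= andbT orbF.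
  by rewrite lt_l (ltn_trans lt_kl) // ltn_eqF // => /(_ isT)/eqP.
by move: ij; rewrite neq_ltn => /orP[]lt; [|rewrite e_sym]; apply: outer.
Qed.

End Structure.

(** * Two disjoint copies of a graph in one color *)

Section TwoCopies.

Variables (G : sgraph) (V : finType).

Definition copy (R : rel V) (g : G -> V) : Prop :=
  injective g /\ forall u w, adj u w -> R (g u) (g w).

Definition two_copies (R : rel V) : Prop :=
  exists g1 g2 : G -> V, [/\ copy R g1, copy R g2 & forall u w, g1 u != g2 w].

Definition two_mono (C : eqType) (e : V -> V -> C) : Prop :=
  exists q, two_copies (fun x y => e x y == q).

Definition two_ramsey (C : eqType) : Prop :=
  forall e : V -> V -> C, (forall x y, e x y = e y x) -> two_mono e.

Variables x0 y0 : G.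
Hypothesis x0y0 : adj x0 y0.
Hypothesis no_isolated : forall x : G, exists y, adj x y.

(** No edge of $2G$ joins its two copies of $G$, so the edge [pq] is harmless once two
    transpositions have moved the images of the two copies of [x0] to [p] and [q]. *)
Lemma two_copies_near_complete (R : rel V) r s p q :
    (#|G| + #|G|).+2 <= #|V| -> uniq [:: r; s; p; q] ->
    (forall x y, x != y -> x \notin [:: r; s] -> y \notin [:: r; s] ->
      ~~ ((x \in [:: p; q]) && (y \in [:: p; q])) -> R x y) ->
  two_copies R.
Proof.
move=> leGV Urspq RP; pose A := ~: [set r; s].
have leGA : #|{: G + G}| <= #|A|.
  rewrite card_sum -(leq_add2l 2) (leq_trans leGV) // -(cardsC [set r; s]).
  by rewrite leq_add2r cards2; case: (r != s).
pose g u := enum_val (widen_ord leGA (enum_rank u)).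
have g_inj : injective g.
  by move=> u w /enum_val_inj/(congr1 val)/= /val_inj/enum_rank_inj.
have gA u : g u \in A by apply: enum_valP.
have [pA qA] : p \in A /\ q \in A.
  move: Urspq; rewrite /= !inE !negb_or -!andbA.
  by case/and5P=> _ rp rq sp /andP[sq _]; rewrite ![p == _]eq_sym ![q == _]eq_sym rp rq sp sq.
have pq : p != q by move: Urspq; rewrite /= !inE => /and4P[].
pose h1 u := tperm (g (inl x0)) p (g u).
pose h u := tperm (h1 (inr x0)) q (h1 u).
have tpA x y z : x \in A -> y \in A -> z \in A -> tperm x y z \in A.
  by case: tpermP => // [->|->].
have hA u : h u \in A by rewrite !tpA.
have h_inj : injective h by move=> u w /perm_inj/perm_inj/g_inj.
have hl : h (inl x0) = p.
  have h1l : h1 (inl x0) = p by rewrite /h1 tpermL.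
  have h1r : h1 (inr x0) != p by rewrite -h1l; apply/eqP => /perm_inj/g_inj.
  by rewrite /h h1l tpermD // eq_sym.
have hr : h (inr x0) = q by rewrite /h tpermL.
have hR u w : u != w -> ~~ ((u \in [:: inl x0; inr x0]) && (w \in [:: inl x0; inr x0])) ->
    R (h u) (h w).
  move=> uw Nuw; apply: RP; rewrite ?(inj_eq h_inj) //.
  - by have := hA u; rewrite !inE.
  - by have := hA w; rewrite !inE.
  by move: Nuw; rewrite -hl -hr !inE !(inj_eq h_inj).
have uw_neq (u w : G) : adj u w -> u != w.
  by apply: contraTneq => ->; rewrite adj_irr.
exists (h \o inl), (h \o inr); split.
- split=> [u w /h_inj[]//|u w uw]; apply: hR; first exact: uw_neq.
  have := uw_neq u w uw; rewrite !inE !orbF.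
  by apply: contraNN => /andP[/eqP[->] /eqP[->]].
- split=> [u w /h_inj[]//|u w uw]; apply: hR; first exact: uw_neq.
  have := uw_neq u w uw; rewrite !inE.
  by apply: contraNN => /andP[/eqP[->] /eqP[->]].
by move=> u w; rewrite /= (inj_eq h_inj).
Qed.

(** Give color 1 to the edges at [r], color 2 to the other edges at [s] and color 0 to the rest.
    Disjoint edges cannot share a star, so both copies have color 0 and, lacking isolated vertices,
    avoid [r] and [s]. *)
Lemma two_ramsey_card : two_ramsey 'I_3 -> (#|G| + #|G|).+2 <= #|V|.
Proof.
(* The constant coloring only serves to obtain two different vertices of [V]. *)
move=> ram; have [_ [g [_ [[g_inj _] _ _]]]] := ram (fun _ _ => ord0) (fun _ _ => erefl).
pose r := g x0; pose s := g y0.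
have rs : r != s by rewrite (inj_eq g_inj); apply: contraTneq x0y0 => ->; rewrite adj_irr.
pose e (x y : V) : 'I_3 := inord (if (x == r) || (y == r) then 1
                         else if (x == s) || (y == s) then 2 else 0).
have [|q [g1 [g2 [[inj1 e1] [inj2 e2] d12]]]] := ram e.
  by move=> x y; rewrite /e ![(x == _) || _]orbC.
have E x y : (e x y == q) -> nat_of_ord q = if (x == r) || (y == r) then 1
                         else if (x == s) || (y == s) then 2 else 0.
  by move=> /eqP<-; rewrite inordK //; do 2?case: ifP.
have stars z : (g1 x0 == z) || (g1 y0 == z) -> (g2 x0 == z) || (g2 y0 == z) -> False.
  by move=> /orP[]/eqP<-; rewrite ![_ == g1 _]eq_sym !(negPf (d12 _ _)).
have := E _ _ (e1 _ _ x0y0); have := E _ _ (e2 _ _ x0y0).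
case: ifP => [r2 ->|_]; first by case: ifP => [r1|_]; [case: (stars r) | case: ifP].
case: ifP => [s2 ->|_ q0 _]; first by case: ifP => // _; case: ifP => // s1; case: (stars s).
have avoid h : (forall u w, adj u w -> e (h u) (h w) == q) -> forall u : G, h u \notin [set r; s].
  move=> eh u; have [w uw] := no_isolated u; have := E _ _ (eh _ _ uw).
  by rewrite q0 !inE; case: (h u == r) => //; case: (h w == r) => //; case: (h u == s).
pose f (u : G + G) := match u with inl u => g1 u | inr u => g2 u end.
have f_inj : injective f.
  move=> [u|u] [w|w] /= => [/inj1->|/eqP|/eqP|/inj2->] //.
    by rewrite (negPf (d12 _ _)).
  by rewrite eq_sym (negPf (d12 _ _)).
have : f @: [set: G + G] \subset ~: [set r; s].
  by apply/subsetP => _ /imsetP[[u|u] _ ->]; rewrite inE avoid.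
move/subset_leq_card; rewrite card_imset // cardsT card_sum -(leq_add2l 2).
by move/leq_trans; apply; rewrite -(cardsC [set r; s]) cards2 rs.
Qed.

(** Numbering the colors in [Q] loses nothing. Diagonal values of [e] may lie outside [Q], so only
    pairs of different vertices are compared. *)
Lemma few_colors (C : finType) (e : V -> V -> C) (Q : {set C}) :
    two_ramsey 'I_3 -> (forall x y, e x y = e y x) -> #|Q| <= 3 ->
    (forall x y, x != y -> e x y \in Q) ->
  two_mono e.
Proof.
move=> ram e_sym leQ eQ.
have [|q [g1 [g2 [[inj1 e1] [inj2 e2] d12]]]] :=
    ram (fun x y => inord (index (e x y) (enum Q))).
  by move=> x y; rewrite e_sym.
have same x y x' y' : x != y -> x' != y' ->
    inord (index (e x y) (enum Q)) == q :> 'I_3 ->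
    inord (index (e x' y') (enum Q)) == q :> 'I_3 -> e x y = e x' y'.
  move=> xy xy' /eqP<- /eqP/(congr1 val).
  have ltQ z z' : z != z' -> index (e z z') (enum Q) < 3.
    by move=> zz'; rewrite (leq_trans _ leQ) // cardE index_mem mem_enum eQ.
  rewrite /= !inordK ?ltQ // => eq_index; symmetry; apply/eqP.
  by rewrite -[_ == _](inj_in_eq (@index_inj _ (e x y) (enum Q))) ?mem_enum ?eQ // eq_index.
have ne g (u w : G) : injective g -> adj u w -> g u != g w :> V.
  by move=> g_inj; apply: contraTneq => /g_inj->; rewrite adj_irr.
exists (e (g1 x0) (g1 y0)), g1, g2; split=> //; split=> // u w uw; apply/eqP.
  by apply: same; rewrite ?ne ?e1.
by apply: same; rewrite ?e1 ?e2 // ne.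
Qed.

End TwoCopies.

(** * Colorings with a dominating color *)

Section Dominated.

Variables (G : sgraph) (V : finType) (C : finType).
Variables (e : V -> V -> C) (a : C) (p : V -> C).
Hypothesis e_sym : forall x y, e x y = e y x.

Variables x0 y0 : G.
Hypothesis x0y0 : adj x0 y0.
Hypothesis no_isolated : forall x : G, exists y, adj x y.
Hypothesis G_conn : forall x y : G, connect (@adj G) x y.

Lemma connected_const (T : Type) (h : G -> T) :
  (forall u w, adj u w -> h u = h w) -> forall u w, h u = h w.
Proof.
move=> hE u w; have /connectP[s + ->] := G_conn u w.
by elim: s u => //= v s IH u /andP[/hE-> /IH].
Qed.

(** The fibers of [p] are the parts: the part of color [q] uses only [a] and [q], and [a] is the
    color between parts. *)
Hypothesis e_dom : forall x y, x != y -> e x y = a \/ (e x y = p x /\ p x = p y).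

Lemma e_parts x y : p x != p y -> e x y = a.
Proof.
move=> pxy; have xy : x != y by apply: contraNneq pxy => ->.
by case: (e_dom xy) => // [[_ eq_p]]; rewrite eq_p eqxx in pxy.
Qed.

Definition mono_in (q : C) (g : G -> V) : Prop := copy (fun x y => e x y == q) g.

Lemma copy_neq (R : rel V) (g : G -> V) u w : copy R g -> adj u w -> g u != g w.
Proof. by case=> g_inj _; apply: contraTneq => /g_inj->; rewrite adj_irr. Qed.

(** An edge not of color [a] stays within a part and has its color; by connectivity the whole copy
    does. *)
Lemma non_a_copy (g : G -> V) : copy (fun x y => e x y != a) g ->
  [/\ forall u, p (g u) = p (g x0), p (g x0) != a & mono_in (p (g x0)) g].
Proof.
move=> g_copy; have [g_inj ge] := g_copy.
have gp u w : adj u w -> e (g u) (g w) = p (g u) /\ p (g u) = p (g w).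
  move=> uw; case: (e_dom (copy_neq g_copy uw)) => // ea.
  by have := ge _ _ uw; rewrite ea eqxx.
have pE := connected_const (fun u w uw => (gp u w uw).2).
have [epg _] := gp _ _ x0y0; split=> [u||]; first exact: pE.
  by rewrite -epg ge.
by split=> // u w uw; have [-> _] := gp _ _ uw; rewrite (pE u x0).
Qed.

Lemma mono_in_part q (g : G -> V) : q != a -> mono_in q g -> forall u, p (g u) = q.
Proof.
move=> qa g_copy u; have [w uw] := no_isolated u.
have /eqP := g_copy.2 _ _ uw.
case: (e_dom (copy_neq g_copy uw)) => [->|[-> _] //] aq.
by rewrite aq eqxx in qa.
Qed.

Definition has_copy (R : rel V) (Q : pred V) : bool :=
  [exists g : {ffun G -> V}, [&& injectiveb g, [forall u, Q (g u)] &
    [forall u, forall w, adj u w ==> R (g u) (g w)]]].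

Lemma has_copyP (R : rel V) (Q : pred V) :
  reflect (exists g : G -> V, copy R g /\ forall u, Q (g u)) (has_copy R Q).
Proof.
apply: (iffP existsP) => [[g /and3P[/injectiveP inj_g /forallP gQ /forallP gR]]|].
  by exists g; split=> //; split=> // u w uw; have /forallP/(_ w)/implyP := gR u; apply.
case=> g [[g_inj gR] gQ]; exists (finfun g); apply/and3P; split.
- by apply/injectiveP => u w; rewrite !ffunE => /g_inj.
- by apply/forallP => u; rewrite ffunE.
by apply/forallP => u; apply/forallP => w; apply/implyP => uw; rewrite !ffunE gR.
Qed.

Definition rich : {set C} :=
  [set q | (q != a) && has_copy (fun x y => e x y == q) predT].

Lemma richP q : reflect (q != a /\ exists g, mono_in q g) (q \in rich).
Proof.
rewrite inE; apply: (iffP andP) => [[qa /has_copyP[g [gP _]]]|[qa [g gP]]].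
  by split=> //; exists g.
by split=> //; apply/has_copyP; exists g.
Qed.

Lemma rich_copies q0 : q0 \in rich ->
  exists f : C -> G -> V, forall q, q \in rich -> mono_in q (f q).
Proof.
case/richP=> _ [g0 _].
apply: (@fin_all_exists C (fun _ => G -> V) (fun q g => q \in rich -> mono_in q g)) => q.
by have [/richP[_ [g gP]]|_] := boolP (q \in rich); [exists g | exists g0].
Qed.

(* Keep one of the two rich colors and merge the other one with all the poor  *)
(* colors: since G is connected, each copy of G that avoids the color [a] has *)
(* a single color, which is rich.                                             *)
Lemma few_rich : two_ramsey G V 'I_3 -> #|rich| <= 2 -> two_mono G e.
Proof.
move=> ram le2.
have [q0 q0P] : exists q0 : C, #|rich :\ q0| <= 1.
  have [/existsP[q qr]|/existsPn none] := boolP [exists q, q \in rich].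
    by exists q; move: le2; rewrite (cardsD1 q) qr.
  exists a; rewrite (_ : _ :\ _ = set0) ?cards0 //; apply/setP => q.
  by rewrite inE (negPf (none q)) andbF inE.
pose e3 x y : 'I_3 := inord (if e x y == a then 0 else if e x y == q0 then 1 else 2).
have [x y|q3 [g1 [g2 [[inj1 e1] [inj2 e2] d12]]]] := ram e3.
  by rewrite /e3 e_sym.
have E x y : e3 x y == q3 -> nat_of_ord q3 =
    if e x y == a then 0 else if e x y == q0 then 1 else 2.
  by move=> /eqP<-; rewrite inordK //; do 2?case: ifP.
have E1 u w (uw : adj u w) := E _ _ (e1 u w uw).
have E2 u w (uw : adj u w) := E _ _ (e2 u w uw).
have [q30|q3N0] := eqVneq (nat_of_ord q3) 0.
  exists a, g1, g2; split=> //; split=> // u w uw.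
    by move: (E1 u w uw); rewrite q30; do 2?case: ifP.
  by move: (E2 u w uw); rewrite q30; do 2?case: ifP.
have c1 : copy (fun x y => e x y != a) g1.
  by split=> // u w uw; apply: contra_neqN q3N0 => ea; rewrite (E1 u w uw) ea.
have c2 : copy (fun x y => e x y != a) g2.
  by split=> // u w uw; apply: contra_neqN q3N0 => ea; rewrite (E2 u w uw) ea.
have [_ a1 m1] := non_a_copy c1; have [_ a2 m2] := non_a_copy c2.
suff eq12 : p (g1 x0) = p (g2 x0).
  by exists (p (g2 x0)), g1, g2; split=> //; rewrite -eq12.
have r1 : p (g1 x0) \in rich by apply/richP; split=> //; exists g1.
have r2 : p (g2 x0) \in rich by apply/richP; split=> //; exists g2.
have := E1 _ _ x0y0; have := E2 _ _ x0y0.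
rewrite (eqP (m1.2 _ _ x0y0)) (eqP (m2.2 _ _ x0y0)) (negPf a1) (negPf a2).
have [->|n2] := eqVneq (p (g2 x0)) q0 => ->; first by case: eqP.
have [//|n1 _] := eqVneq (p (g1 x0)) q0.
by apply: (card_le1_eqP q0P); rewrite in_setD1 ?n1 ?n2.
Qed.

Variable f : C -> G -> V.
Hypothesis f_mono : forall q, q \in rich -> mono_in q (f q).

Lemma f_part q u : q \in rich -> p (f q u) = q.
Proof.
move=> qr; have [qa _] := richP q qr.
exact: (mono_in_part qa (f_mono qr)).
Qed.

Lemma f_eq q q' u u' : q \in rich -> q' \in rich -> f q u = f q' u' -> q = q' /\ u = u'.
Proof.
move=> qr qr' eq_f; have eq_q : q = q' by rewrite -(f_part u qr) eq_f f_part.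
by split=> //; apply: (f_mono qr).1; rewrite eq_f eq_q.
Qed.

(* In the recoloring below, a copy of G avoiding the color [a] lies within one*)
(* class: class 1 is one vertex too small for it, and on class 0 it would be  *)
(* disjoint from the copy [f q].                                              *)
Definition class (q : C) (x : V) : nat :=
  if x == f q x0 then 2 else x \in codom (f q).

(* Recoloring of the part of color [q]: [true] stands for the color [a].      *)
Definition recolor (q : C) (x y : V) : bool :=
  if (class q x == 0) && (class q y == 0) then e x y == a
  else class q x != class q y.

Definition bad (q : C) : bool := has_copy (recolor q) (fun x => p x == q).

Lemma e_a x y : p x != p y -> e x y == a.
Proof. by move/e_parts->. Qed.

(* Vertices of classes 1 and 2 in a bad copy are moved into the copies of G   *)
(* fixed in two other parts: the edges between parts all have the color [a].  *)
Lemma bad_unique q1 q2 q3 : uniq [:: q1; q2; q3] -> {subset [:: q1; q2; q3] <= rich} ->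
  bad q1 -> bad q2 -> two_mono G e.
Proof.
move=> Uq sub; have [r1 r2 r3] : [/\ q1 \in rich, q2 \in rich & q3 \in rich].
  by rewrite !sub ?inE ?eqxx ?orbT.
have ne (u w : G) : adj u w -> u != w by apply: contraTneq => ->; rewrite adj_irr.
pose F q q' (h : G -> V) z u :=
  if class q (h u) is n.+1 then (if n == 0 then f q' u else f q3 z) else h u.
have F_copy q q' h z : uniq [:: q; q'; q3] -> q \in rich -> q' \in rich ->
    copy (recolor q) h -> (forall u, p (h u) == q) ->
    copy (fun x y => e x y == a) (F q q' h z).
  move=> Unth qr q'r [h_inj hR] hp.
  (* After the move the class determines the part, so edges between different classes become edges
     between parts. *)
  have pF u : p (F q q' h z u) = nth q [:: q; q'; q3] (class q (h u)).
    rewrite /F /class; case: ifP => _ /=; first by rewrite f_part.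
    by case: (_ \in _); rewrite /= ?f_part ?(eqP (hp u)).
  have le2 u : class q (h u) < 3 by rewrite /class; case: ifP => // _; case: (_ \in _).
  split=> [u w eqF|u w uw].
    have eq_c : class q (h u) = class q (h w).
      by apply/eqP; rewrite -(nth_uniq q _ _ Unth) ?le2 // -!pF eqF.
    move: eqF; rewrite /F eq_c; case cw: (class q (h w)) => [|[|n]] /=.
    - by move=> /h_inj.
    - by move=> /(f_mono q'r).1.
    have two v : class q (h v) = n.+2 -> h v = f q x0.
      by rewrite /class; case: eqP => // _; case: (_ \in _).
    by move=> _; apply: h_inj; rewrite (two w cw) two // eq_c.
  have := hR u w uw; rewrite /recolor; case: ifP => [/andP[/eqP cu /eqP cw]|_ ncl].
    by rewrite /F cu cw.
  by apply: e_a; rewrite !pF nth_uniq ?le2.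
case/has_copyP=> h1 [c1 p1] /has_copyP[h2 [c2 p2]].
have U21 : uniq [:: q2; q1; q3].
  by move: Uq; rewrite /= !inE !negb_or !andbT [q2 == q1]eq_sym andbAC => /andP[/andP[-> ->] ->].
(* The class 2 vertices of the two bad copies go to different vertices of the third fixed copy, as
   [x0] and [y0] differ. *)
exists a, (F q1 q2 h1 x0), (F q2 q1 h2 y0); split; [exact: F_copy|exact: F_copy|].
move: Uq; rewrite /= !inE negb_or andbT => /andP[/andP[n12 n13] n23] u w.
have cl0 q v : class q v = 0 -> v \notin codom (f q).
  by rewrite /class; case: ifP => // _; case: (_ \in _).
have by_part x y : p x != p y -> x != y by apply: contraNneq => ->.
rewrite /F; case c_u: (class q1 (h1 u)) => [|[|n]]; case c_w: (class q2 (h2 w)) => [|[|m]] /=.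
- by apply: by_part; rewrite (eqP (p1 u)) (eqP (p2 w)).
- by apply: contraNneq (cl0 _ _ c_u) => ->; apply: codom_f.
- by apply: by_part; rewrite (eqP (p1 u)) f_part.
- by apply: contraNneq (cl0 _ _ c_w) => <-; apply: codom_f.
- by apply: by_part; rewrite !f_part // eq_sym.
- by apply: by_part; rewrite !f_part.
- by apply: by_part; rewrite (eqP (p2 w)) f_part // eq_sym.
- by apply: by_part; rewrite !f_part // eq_sym.
by rewrite (inj_eq (f_mono r3).1) ne.
Qed.

(** By connectivity the copy lies in one class. Class 0 gives a copy of color [q] disjoint from
    [f q]; the other classes have fewer than [#|G|] vertices. *)
Lemma not_bad_copy q (g : G -> V) : q \in rich -> (forall u, p (g u) = q) ->
  copy (fun x y => ~~ recolor q x y) g -> two_mono G e.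
Proof.
move=> qr gp g_copy; have [g_inj ge] := g_copy.
have cE : forall u w, class q (g u) = class q (g w).
  apply: connected_const => u w /ge; rewrite /recolor.
  by case: ifP => [/andP[/eqP-> /eqP->]|_ /negPn/eqP].
have [c0|c_pos] := posnP (class q (g x0)).
  have g_nona : copy (fun x y => e x y != a) g.
    split=> // u w uw; have := ge u w uw.
    by rewrite /recolor (cE u x0) (cE w x0) c0.
  have [_ _ mg] := non_a_copy g_nona; rewrite gp in mg.
  exists q, g, (f q); split=> //; first exact: f_mono.
  move=> u w; have := cE u x0; rewrite c0 /class; case: ifP => // _.
  by case: (boolP (_ \in _)) => // nf _; apply: contraNneq nf => ->; apply: codom_f.
exfalso.
have [g0|ng0] := eqVneq (g x0) (f q x0).
  have : class q (g y0) = 2 by rewrite -(cE x0) /class g0 eqxx.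
  rewrite /class; case: eqP => [g1 _|_]; last by case: (_ \in _).
  by have := copy_neq g_copy x0y0; rewrite g0 g1 eqxx.
have c1 : class q (g x0) = 1.
  by move: c_pos; rewrite /class (negPf ng0); case: (_ \in _).
have gA : {subset codom g <= [predD1 codom (f q) & f q x0]}.
  move=> _ /codomP[u ->]; have := cE u x0; rewrite c1 /class inE /=.
  by case: ifP => // _; case: (_ \in _).
have /subset_leq_card := introT subsetP gA.
rewrite card_codom // -(card_codom (f_mono qr).1) [leqLHS](cardD1 (f q x0)).
by rewrite codom_f add1n ltnn.
Qed.

(* The edges between two parts get the color 2. If G occurs in it, then G is  *)
(* colored with the rich colors, and two copies of G in color [a] run through *)
(* the copies [f q], the second one with the colors shifted cyclically.       *)
Lemma many_rich : two_ramsey G V 'I_3 -> 2 < #|rich| -> two_mono G e.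
Proof.
move=> ram gt2.
have [q0 q0r good] : exists2 q0, q0 \in rich &
   two_mono G e \/ forall q, q \in rich -> q != q0 -> ~~ bad q.
  have [/existsP[q0 /andP[q0r b0]]|/existsPn none] := boolP [exists q, (q \in rich) && bad q].
    exists q0 => //; have [/existsP[q1 /and3P[q1r n10 b1]]|/existsPn good] :=
      boolP [exists q, [&& q \in rich, q != q0 & bad q]]; last first.
      by right=> q qr nq; have := good q; rewrite qr nq.
    left; have [q2] : exists q2, q2 \in rich :\ q0 :\ q1.
      apply/card_gt0P; move: gt2; rewrite (cardsD1 q0) q0r (cardsD1 q1) in_setD1 n10 q1r.
      by rewrite !add1n !ltnS.
    rewrite !in_setD1 => /and3P[n21 n20 q2r].
    apply: (@bad_unique q0 q1 q2) => //.
      by rewrite /= !inE negb_or andbT ![_ == q2]eq_sym n20 n21 eq_sym n10.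
    by move=> q; rewrite !in_cons in_nil orbF => /or3P[]/eqP->.
  have /card_gt0P[q0 q0r] : 0 < #|rich| by rewrite (leq_trans _ gt2).
  exists q0 => //; right=> q qr _; have := none q; by rewrite qr.
case: good => // good.
(* The part of [q0], the only rich color that may be bad, absorbs all vertices outside the rich
   parts. *)
pose part x := if p x \in rich then p x else q0.
have part_rich x : part x \in rich by rewrite /part; case: ifP.
have part_p x : part x != q0 -> p x = part x.
  by rewrite /part; case: ifP => //; rewrite eqxx.
pose e3 x y : 'I_3 := inord (if part x != part y then 2 else
  if part x == q0 then e x y != a : nat else ~~ recolor (part x) x y : nat).
have recolor_sym q x y : recolor q x y = recolor q y x.
  by rewrite /recolor andbC e_sym [class q x == class _ _]eq_sym.
have [x y|q3 [g1 [g2 [c1 c2 d12]]]] := ram e3.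
  rewrite /e3 eq_sym; case: eqP => //= ->.
  by rewrite e_sym recolor_sym.
have E x y : e3 x y == q3 -> nat_of_ord q3 = if part x != part y then 2 else
    if part x == q0 then e x y != a : nat else ~~ recolor (part x) x y : nat.
  move=> /eqP<-; rewrite inordK //; do 2?[case: ifP => // _]; first by case: (_ != _).
  by case: (recolor _ _ _).
have [q3_2|q3_lt2] := eqVneq (nat_of_ord q3) 2.
  (* This is a proper coloring of [G]; shifting it along the cycle of rich colors changes every
     value, which makes the two copies disjoint. *)
  pose phi u := part (g1 u).
  have phiP u w : adj u w -> phi u != phi w.
    move=> uw; have := E _ _ (c1.2 _ _ uw); rewrite q3_2 /phi; case: eqP => //= _.
    by case: ifP => _; [case: (_ != _)|case: (recolor _ _ _)].
  have next_rich q : q \in rich -> next (enum rich) q \in rich.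
    by rewrite -[next _ _ \in _]mem_enum mem_next mem_enum.
  have next_ne q : q \in rich -> next (enum rich) q != q.
    move=> qr; rewrite eq_sym.
    apply: (@next_cycle _ [rel x y | x != y]); last by rewrite mem_enum.
    have := enum_uniq rich; have: 2 < size (enum rich) by rewrite -cardE.
    case: (enum rich) => // y s; rewrite ltnS => gt1 Us.
    rewrite /= rcons_path; apply/andP; split.
      by rewrite uniq_pairwise in Us; apply: (pairwise_sorted Us).
    case: s gt1 Us => //= z s _ /andP[yNs _].
    by apply: contraNneq yNs => <-; apply: mem_last.
  have next_inj : injective (next (enum rich)).
    by apply: (can_inj (prev_next (enum_uniq _))).
  have psi_copy (psi : G -> C) : (forall u, psi u \in rich) ->
      (forall u w, adj u w -> psi u != psi w) ->
      copy (fun x y => e x y == a) (fun u => f (psi u) u).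
    move=> psi_r psi_ne; split=> [u w /f_eq[] //|u w uw].
    by apply: e_a; rewrite !f_part ?psi_ne.
  exists a, (fun u => f (phi u) u), (fun u => f (next (enum rich) (phi u)) u); split.
  - by apply: psi_copy => // u; apply: part_rich.
  - apply: (psi_copy (fun u => next (enum rich) (phi u))) => u.
      by apply: next_rich; apply: part_rich.
    by move=> w uw; rewrite (inj_eq next_inj) phiP.
  move=> u w; apply/eqP => /f_eq[||eq_q eq_uw]; rewrite ?next_rich ?part_rich //.
  by have := next_ne (phi w) (part_rich _); rewrite -eq_q eq_uw eqxx.
have partE g : copy (fun x y => e3 x y == q3) g -> forall u, part (g u) = part (g x0).
  move=> [_ gE] u; apply: (@connected_const _ (part \o g)) => {}u w uw; apply/eqP.
  by apply: contraNT q3_lt2 => ne; rewrite (E _ _ (gE _ _ uw)) ne.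
(* A single copy in another part suffices: color 0 would make that part bad, and color 1 is the case
   of [not_bad_copy]. *)
have outside g : copy (fun x y => e3 x y == q3) g -> part (g x0) != q0 -> two_mono G e.
  move=> cg ne; have gp u : p (g u) = part (g x0) by rewrite part_p !(partE g cg).
  have g3 u w : adj u w -> nat_of_ord q3 = ~~ recolor (part (g x0)) (g u) (g w).
    move=> uw; rewrite (E _ _ (cg.2 _ _ uw)) (partE g cg u) (partE g cg w) eqxx /=.
    by rewrite (negPf ne).
  have [q3_0|q3_1] := eqVneq (nat_of_ord q3) 0.
    have /negP[] := good _ (part_rich (g x0)) ne; apply/has_copyP; exists g.
    split=> [|u]; last by rewrite gp.
    split=> [|u w uw]; first exact: cg.1.
    by move: (g3 u w uw); rewrite q3_0; case: (recolor _ _ _).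
  apply: (not_bad_copy (part_rich (g x0)) gp); split=> [|u w uw]; first exact: cg.1.
  by apply: contraNN q3_1 => rec; rewrite (g3 u w uw) rec.
have [p1|] := eqVneq (part (g1 x0)) q0; last exact: outside.
have [p2|] := eqVneq (part (g2 x0)) q0; last exact: outside.
have g3 g u w : copy (fun x y => e3 x y == q3) g -> part (g x0) = q0 -> adj u w ->
    nat_of_ord q3 = (e (g u) (g w) != a).
  by move=> cg pg uw; rewrite (E _ _ (cg.2 _ _ uw)) (partE g cg u) (partE g cg w) pg !eqxx.
have [q3_0|q3_1] := eqVneq (nat_of_ord q3) 0.
  have in_a g : copy (fun x y => e3 x y == q3) g -> part (g x0) = q0 ->
      copy (fun x y => e x y == a) g.
    move=> cg pg; split=> [|u w uw]; first exact: cg.1.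
    by have := g3 g u w cg pg uw; rewrite q3_0; case: eqP.
  by exists a, g1, g2; split=> //; apply: in_a.
have in_q0 g : copy (fun x y => e3 x y == q3) g -> part (g x0) = q0 -> mono_in q0 g.
  move=> cg pg; have [|_ pa mg] := @non_a_copy g.
    split=> [|u w uw]; first exact: cg.1.
    by apply: contraNN q3_1 => ea; rewrite (g3 g u w cg pg uw) ea.
  (* The copy itself shows that its color is rich, so it was not absorbed and its color is [q0]. *)
  have rp : p (g x0) \in rich by apply/richP; split=> //; exists g.
  by move: mg; rewrite -[in mono_in q0 g]pg /part rp.
by exists q0, g1, g2; split=> //; apply: in_q0.
Qed.

End Dominated.

(** * The theorem *)

Section Final.

Variables (G : sgraph) (V C : finType) (e : V -> V -> C).
Hypothesis e_sym : forall x y, e x y = e y x.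
Variables x0 y0 : G.
Hypothesis x0y0 : adj x0 y0.
Hypothesis no_isolated : forall x : G, exists y, adj x y.
Hypothesis G_conn : forall x y : G, connect (@adj G) x y.
Hypothesis ram : two_ramsey G V 'I_3.

Lemma dominated_two_mono a p :
    (forall x y, x != y -> e x y = a \/ (e x y = p x /\ p x = p y)) ->
  two_mono G e.
Proof.
move=> e_dom; have [le2|gt2] := leqP #|rich G e a| 2.
  exact: (few_rich e_sym x0y0 G_conn e_dom).
have /card_gt0P[q0 q0r] : 0 < #|rich G e a| by rewrite (leq_trans _ gt2).
have [f f_mono] := rich_copies q0r.
exact: (many_rich e_sym x0y0 no_isolated G_conn e_dom f_mono).
Qed.

(** For a triangle core with forced color [z]: if at most one vertex [q] outside the triangle is
    joined to [c] in another color, drop [a] and [b]. Otherwise each outer [y] has an outer [w]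
    different from [y] with [wc] not of color [z], which forces [z] on [ya]; then drop [b] and
    [c]. *)
Lemma core_two_mono a b c d : 6 <= #|V| -> p5_free e -> uniq [:: a; b; c; d] ->
  star_core e a b c d \/ triangle_core e a b c d -> two_mono G e.
Proof.
move=> V_ge6 e_free Us; have leGV := two_ramsey_card x0y0 no_isolated ram.
have nmem (x y z : V) : x \notin [:: y; z] -> x != y /\ x != z.
  by rewrite !inE negb_or => /andP.
case=> [core|core].
  exists (e b c); apply: (two_copies_near_complete x0 leGV Us) => x y xy.
  move=> /nmem[xa _] /nmem[ya _] _.
  by rewrite (star_core_mono e_sym e_free V_ge6 Us core).
have outer := triangle_core_outer e_sym e_free V_ge6 Us core.
have {Us} [Us Nd] : uniq [:: a; b; c] /\ d \notin [:: a; b; c].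
  by move: Us; rewrite -[_ :: _]/(rcons [:: a; b; c] d) rcons_uniq => /andP[].
set z := e d b in outer *; exists z.
have near r s t q : perm_eq [:: r; s; t] [:: a; b; c] -> q \notin [:: a; b; c] ->
    (forall y, y \notin [:: a; b; c] -> y != q -> e y t = z) ->
    two_copies G (fun x y => e x y == z).
  move=> perm_rst Nq tz; have mem_rst := perm_mem perm_rst.
  apply: (two_copies_near_complete x0 leGV (r := r) (s := s) (p := t) (q := q)).
    rewrite -[[:: r; s; t; q]]/(rcons [:: r; s; t] q) rcons_uniq.
    by rewrite mem_rst Nq (perm_uniq perm_rst).
  have cases x : x \notin [:: r; s] -> x = t \/ x \notin [:: a; b; c].
    move=> Nrs; have [->|xt] := eqVneq x t; [by left | right].
    by rewrite -mem_rst; move: Nrs xt; rewrite !inE !negb_or => /andP[-> ->].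
  move=> x y xy /cases xc /cases yc.
  case: xc yc xy => [->|xT] [->|yT] xy; rewrite ?eqxx // in xy *.
  - by rewrite !inE eqxx /= => /norP[_ yq]; rewrite e_sym tz.
  - by rewrite !inE eqxx andbT => /norP[_ xq]; rewrite tz.
  by have [-> _] := outer x y xy xT yT.
have [/existsP[q /andP[Nq /forallP cq]]|none] := boolP [exists q, (q \notin [:: a; b; c]) &&
    [forall y, (y \notin [:: a; b; c]) ==> (y != q) ==> (e y c == z)]].
  apply: (near a b c q) => // y yT yq.
  by have := cq y; rewrite yT yq => /eqP.
apply: (near b c a d) => //.
  by rewrite -[[:: b; c; a]]/(rot 1 [:: a; b; c]) perm_rot.
move=> y yT yd.
have /existsPn/(_ y) := none; rewrite yT /= => /forallPn[w].
rewrite !negb_imply => /and3P[wT wy wc].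
by have [_ []] := outer w y wy wT yT; [move/eqP; rewrite (negPf wc)|].
Qed.

Lemma p5_free_two_mono : p5_free e -> two_mono G e.
Proof.
move=> e_free; have leGV := two_ramsey_card x0y0 no_isolated ram.
have G_ge2 : 1 < #|G|.
  apply/card_gt1P; exists x0, y0; split=> //.
  by apply: contraTneq x0y0 => ->; rewrite adj_irr.
have V_ge6 : 6 <= #|V| by rewrite (leq_trans _ leGV) // !ltnS (leq_add G_ge2 G_ge2).
pose S v : {set C} := [set e v x | x in [set~ v]].
have S_e x y : x != y -> e x y \in S x.
  by move=> xy; apply/imsetP; exists y; rewrite // !inE eq_sym.
have [/existsP[v /card_gt2P]|/existsPn S_le2] := boolP [exists v, 2 < #|S v|].
  case=> _ [_ [_ [[/imsetP[p1 + ->] /imsetP[p2 + ->] /imsetP[p3 + ->]] [n12 n23 n31]]]].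
  rewrite !inE => v1 v2 v3.
  have Us : uniq [:: v; p1; p2; p3].
    rewrite /= !inE !negb_or ![v == _]eq_sym v1 v2 v3 /= andbT.
    by rewrite -!andbA; apply/and3P; split; [apply: contraNneq n12|apply: contraNneq n31|
       apply: contraNneq n23] => ->.
  have [/existsP[s /existsP[t /andP[st Nst]]]|none] := boolP [exists s, exists t,
      (s != t) && (e s t \notin [:: e v p1; e v p2; e v p3])].
    have [|a [b [c [d [Uabcd core]]]]] := core_exists e_sym e_free V_ge6 Us st.
      rewrite -[_ :: _]/(rcons [:: _; _; _] _) rcons_uniq Nst /= !inE negb_or n12 n23.
      by rewrite eq_sym n31.
    exact: (core_two_mono V_ge6 e_free Uabcd).
  apply: (few_colors (Q := [set x in [:: e v p1; e v p2; e v p3]]) x0y0 ram e_sym).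
    by rewrite cardsE (leq_trans (card_size _)).
  move=> x y xy; rewrite inE; apply: contraNT none => Nxy.
  by apply/existsP; exists x; apply/existsP; exists y; rewrite xy.
have S_three v q1 q2 q3 : q1 \in S v -> q2 \in S v -> q3 \in S v ->
    [|| q1 == q2, q2 == q3 | q3 == q1].
  move=> s1 s2 s3; apply: contraR (S_le2 v); rewrite !negb_or => /and3P[n12 n23 n31].
  by apply/card_gt2P; exists q1, q2, q3.
have [/existsP[a /forallP aS]|no_common] := boolP [exists a, forall v, a \in S v].
  (* The color at [v] other than [a]; the default [a] serves vertices that see only [a]. *)
  pose p v := odflt a [pick q in S v :\ a].
  have pE x y : x != y -> e x y != a -> p x = e x y.
    move=> xy ea; rewrite /p; case: pickP => [q|/(_ (e x y))]; last first.
      by rewrite !inE ea S_e.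
    rewrite in_setD1 => /andP[qa qS] /=.
    have := S_three x q (e x y) a qS (S_e _ _ xy) (aS x).
    by rewrite (negPf ea) [a == q]eq_sym (negPf qa) !orbF => /eqP.
  apply: (@dominated_two_mono a p) => x y xy.
  have [|ea] := eqVneq (e x y) a; [by left|right].
  have yx : y != x by rewrite eq_sym.
  by rewrite (pE x y) // (pE y x) ?(e_sym y).
(* Without a common color, these pairwise meeting sets of size at most two include [{a, b}],
   [{b, c}] and [{c, a}]. Every [S x] meets all three, hence contains two of the three colors and
   nothing else. *)
have meet v w : v != w -> exists2 q, q \in S v & q \in S w.
  by move=> vw; exists (e v w); [|rewrite e_sym]; apply: S_e; rewrite // eq_sym.
have avoid a : exists v, a \notin S v.
  by move: no_common; rewrite negb_exists => /forallP/(_ a)/forallPn.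
have [v0 [a a0]] : exists v0 a, a \in S v0.
  have /card_gt1P[v [w [_ _ vw]]] : 1 < #|V| by rewrite (leq_trans _ V_ge6).
  by exists v, (e v w); apply: S_e.
have ne v w a' : a' \in S v -> a' \notin S w -> v != w.
  by move=> av; apply: contraNneq => <-.
have [v1 a1] := avoid a; have [b b0 b1] := meet v0 v1 (ne _ _ _ a0 a1).
have [v2 b2] := avoid b; have [c c1 c2] := meet v1 v2 (ne _ _ _ b1 b2).
have ab : a != b by apply: contraNneq a1 => ->.
have bc : b != c by apply: contraNneq b2 => ->.
have ca : c != a by apply: contraNneq a1 => <-.
have in0 q : q \in S v0 -> q = a \/ q = b.
  move=> /S_three/(_ a0 b0)/or3P[]/eqP; [by left|move/eqP: ab; contradiction|by right].
have in1 q : q \in S v1 -> q = b \/ q = c.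
  by move=> /S_three/(_ b1 c1)/or3P[]/eqP; [left|move/eqP: bc; contradiction|right].
have [a' /in0[->|->] a2] := meet v0 v2 (ne _ _ _ b0 b2); last by rewrite a2 in b2.
have in2 q : q \in S v2 -> q = c \/ q = a.
  by move=> /S_three/(_ c2 a2)/or3P[]/eqP; [left|move/eqP: ca; contradiction|right].
apply: (few_colors (Q := [set x in [:: a; b; c]]) x0y0 ram e_sym).
  by rewrite cardsE (leq_trans (card_size _)).
move=> x y xy; rewrite inE; apply/negPn/negP => NQ.
have eS := S_e _ _ xy.
have meet_x v : exists2 q, q \in S v & q \in S x.
  by have [<-|] := eqVneq x v; [exists (e x y) | move=> /meet[q]; exists q].
have clash q1 q2 : q1 \in [:: a; b; c] -> q2 \in [:: a; b; c] -> q1 != q2 ->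
    q1 \in S x -> q2 \in S x -> False.
  move=> Q1 Q2 n12 s1 s2; have := S_three x q1 q2 (e x y) s1 s2 eS.
  rewrite (negPf n12) /= => /orP[]/eqP eq_e; first by rewrite -eq_e Q2 in NQ.
  by rewrite eq_e Q1 in NQ.
have [q /in0 q0 q0x] := meet_x v0; have [q' /in1 q1 q1x] := meet_x v1.
have [q'' /in2 q2 q2x] := meet_x v2.
have := clash a b; have := clash b c; have := clash c a.
rewrite ab bc ca !inE !eqxx !orbT => Hca Hbc Hab.
case: q0 q0x => -> q0x; case: q1 q1x => -> q1x; try exact: Hab; try exact: Hbc;
  try exact: Hca; by case: q2 q2x => -> q2x; [apply: Hbc|apply: Hab].
Qed.

End Final.

(** * From colorings of vertex sets to symmetric functions *)

Lemma mono_copy_double (G : sgraph) k n (c : coloring k n) :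
  reflect (two_mono G (fun x y => c [set x; y])) (mono_copy (double_graph G) c).
Proof.
apply: (iffP existsP) => [[f /andP[/injectiveP f_inj /existsP[q /forallP fq]]]|].
  have fE u v : adj u v -> c [set f u; f v] == q.
    by have /forallP/(_ v)/implyP := fq u.
  exists q, (fun u => f (inl u)), (fun u => f (inr u)); split.
  - by split=> [u w /f_inj[]|u w uw] //; apply: fE.
  - by split=> [u w /f_inj[]|u w uw] //; apply: fE.
  by move=> u w; rewrite (inj_eq f_inj).
case=> q [g1 [g2 [[inj1 e1] [inj2 e2] d12]]].
exists (finfun (fun u : double_graph G =>
  match u with inl u => g1 u | inr u => g2 u end)); apply/andP; split.
  apply/injectiveP => -[u|u] [w|w]; rewrite !ffunE.
  - by move/inj1->.
  - by move/eqP; rewrite (negPf (d12 _ _)).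
  - by move/eqP; rewrite eq_sym (negPf (d12 _ _)).
  - by move/inj2->.
apply/existsP; exists q; apply/forallP => u; apply/forallP => v; apply/implyP.
by case: u v => [u|u] [v|v] //= uv; rewrite !ffunE ?e1 ?e2.
Qed.

Lemma ramsey_two_ramsey (G : sgraph) n :
  ramsey_prop 3 (double_graph G) n -> two_ramsey G 'I_n 'I_3.
Proof.
move=> /forallP ram e e_sym.
pose c : coloring 3 n := [ffun X : {set 'I_n} =>
  if [pick p : 'I_n * 'I_n | X == [set p.1; p.2]] is Some p then e p.1 p.2 else ord0].
have cE x y : c [set x; y] = e x y.
  rewrite ffunE; case: pickP => [[x' y'] /= /eqP eq_xy|/(_ (x, y))]; last by rewrite eqxx.
  have [x'_xy y'_xy] : x' \in [set x; y] /\ y' \in [set x; y].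
    by rewrite eq_xy !inE !eqxx orbT.
  have [x_xy y_xy] : x \in [set x'; y'] /\ y \in [set x'; y'].
    by rewrite -eq_xy !inE !eqxx orbT.
  move: x'_xy y'_xy x_xy y_xy; rewrite !inE.
  case/orP=> /eqP->; case/orP=> /eqP-> //.
  - by move=> _; rewrite orbb => /eqP->.
  - by rewrite orbb => /eqP->.
have /mono_copy_double[q [g1 [g2 [[inj1 e1] [inj2 e2] d12]]]] := ram c.
by exists q, g1, g2; split=> //; split=> // u w uw; rewrite -cE ?e1 ?e2.
Qed.

Lemma not_rainbow_p5_free k n (c : coloring k n) :
  ~~ rainbow_copy (path_graph 5) c -> p5_free (fun x y => c [set x; y]).
Proof.
move=> no_rainbow x s szs Us; apply: contra no_rainbow => Uc.
pose e := fun x y => c [set x; y].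
apply/existsP; exists [ffun i : 'I_5 => nth x (x :: s) i]; apply/andP; split.
  apply/injectiveP => i j /eqP; rewrite !ffunE nth_uniq //= ?szs ?ltn_ord //.
  by move/eqP/val_inj.
(* An edge of the path is identified by its smaller end [m], which is also the position of its color
   in [pairmap]. *)
have fE (u v : 'I_5) : path_adj u v -> exists2 m, m < 4 &
    (minn u v = m /\ maxn u v = m.+1) /\
    c [set nth x (x :: s) u; nth x (x :: s) v] = nth (e x x) (pairmap e x s) m.
  have step m : m < 4 ->
      nth (e x x) (pairmap e x s) m = e (nth x (x :: s) m) (nth x (x :: s) m.+1).
    by move=> lt_m; rewrite (nth_pairmap x) ?szs //.
  case/orP=> /eqP uv.
    have lt_u : u < 4 by rewrite -ltnS uv ltn_ord.
    by exists u; rewrite // step // uv (minn_idPl _) ?(maxn_idPr _) // -uv.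
  have lt_v : v < 4 by rewrite -ltnS uv ltn_ord.
  exists v; rewrite // step // uv (minn_idPr _) ?(maxn_idPl _) -?uv //.
  by split=> //; rewrite /e setUC.
apply/forallP => u; apply/forallP => v; apply/forallP => y; apply/forallP => z.
apply/implyP => /and3P[/fE[m lt_m [[min_m max_m] cm]] /fE[m' lt_m' [[min_m' max_m'] cm']] ne].
rewrite !ffunE cm cm' nth_uniq ?size_pairmap ?szs //.
apply: contra_neqN ne => /eqP eq_m.
apply/setP => i; rewrite !inE.
have pairE (w w' : 'I_5) : minn w w' = m -> maxn w w' = m.+1 ->
    (i == w) || (i == w') = (val i == m) || (val i == m.+1).
  by rewrite -!val_eqE /= => <- <-; case: leqP => _; rewrite // orbC.
by rewrite (pairE u v) // (pairE y z) // eq_m.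
Qed.

Theorem theorem4p12 (G : sgraph) (hconn : connected_graph G) (hedge : has_edge G) :
  ~ in_scrH (double_graph G).
Proof.
move=> [iso [k [_ lt_gr]]]; move: lt_gr; rewrite ltnNge => /negP[].
rewrite /gallai_ramsey; case: ex_minnP => m _; apply.
rewrite /ramsey; case: ex_minnP => n /ramsey_two_ramsey ram _.
apply/forallP => c; have [//|/not_rainbow_p5_free c_free] := boolP (rainbow_copy _ c).
apply/mono_copy_double; have [x0 [y0 x0y0]] := hedge.
apply: (p5_free_two_mono _ x0y0 _ hconn.2 ram c_free) => [x y|x].
  by rewrite setUC.
by have [[y|y] xy] := iso (inl x); [exists y |].
Qed.
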